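(* Let $p$ be an odd prime and let $s \in \mathbb{N}=\{1,2,3,\dots\}$. For all $m_1,\ldots,m_s,n_1,\ldots,n_s,k \in \mathbb{Z}_+=\{0,1,2,\dots\}$ with $m_1n_1+\cdots+m_sn_s > (m_1+\cdots+m_s)k$, $$\int_{\mathbb{Z}_p} \left(\prod_{i=1}^{s} B_{k,n_i}^{m_i}(x)\right) d\mu_{-1}(x) = \begin{cases} 2+E_{m_1n_1+\cdots+m_sn_s} & \text{if } k=0,\\[2mm] \displaystyle\left(\prod_{i=1}^{s}\binom{n_i}{k}^{m_i}\right)\sum_{j=0}^{k\sum_{i=1}^s m_i}\binom{k\sum_{i=1}^s m_i}{j}(-1)^{k\sum_{i=1}^s m_i-j}E_{\sum_{i=1}^{s}n_im_i-j} & \text{if } k>0.\end{cases}$$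
   Context: For a uniformly differentiable function $f:\mathbb{Z}_p \to \mathbb{C}_p$ (in particular any polynomial), the fermionic $p$-adic invariant integral on $\mathbb{Z}_p$ is $$\int_{\mathbb{Z}_p} f(x)\, d\mu_{-1}(x) = \lim_{N\to\infty} \sum_{x=0}^{p^N-1} f(x)(-1)^x,$$ where the limit is taken in the $p$-adic topology. For $k,n\in\mathbb{Z}_+$ the Bernstein polynomial is $B_{k,n}(x) = \binom{n}{k} x^k (1-x)^{n-k}$ for $k \le n$, and $B_{k,n}(x)=0$ for $n<k$ (where $\binom{n}{k}=0$). $B_{k,n}^{m}(x)$ denotes the $m$-th power $(B_{k,n}(x))^m$; zeroth powers are equal to $1$ (including $0^0=1$). The Euler numbers $E_n\in\mathbb{Q}$ ($n\ge 0$) are defined by $\frac{2}{e^t+1} = \sum_{n=0}^{\infty} E_n \frac{t^n}{n!}$ and are regarded as elements of $\mathbb{Q}_p$. *)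

(* Defs.v *)
From HB Require Import structures.
From mathcomp Require Import all_boot all_order all_algebra.
From mathcomp Require Import boolp classical_sets reals.
From mathcomp Require Import topology normedtype sequences.

Set Implicit Arguments.
Unset Strict Implicit.
Unset Printing Implicit Defensive.

Import Order.TTheory GRing.Theory Num.Theory.
Import numFieldNormedType.Exports.
Local Open Scope ring_scope.

(* The ring of p-adic integers as the inverse limit of the Z/p^n: x n is the
   residue of x modulo p^n, represented in [0, p^n).  The argument pr only
   serves to attach the ring structure. *)
Definition padicZ_coherent (p : nat) (x : nat -> nat) : Prop :=
  forall n, x n = (x n.+1 %% p ^ n)%N.

Record padicZ (p : nat) (pr : prime p) :=
  MkPadicZ { padicZ_res :> nat -> nat; _ : `[< padicZ_coherent p padicZ_res >] }.

Section ZpRing.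
Variables (p : nat) (pr : prime p).
Notation Z := (padicZ pr).

HB.instance Definition _ := [isSub for @padicZ_res p pr].
HB.instance Definition _ := [Choice of Z by <:].

Implicit Types x y z : Z.

Lemma padicZ_eq x y : (forall n, x n = y n) -> x = y.
Proof. by move=> xy; apply: val_inj; apply/funext. Qed.

Lemma padicZ_resE x n : x n = (x n.+1 %% p ^ n)%N.
Proof. by case: x => f /= /asboolP. Qed.

Lemma padicZ_res_mod x n : (x n %% p ^ n)%N = x n.
Proof. by rewrite [in LHS]padicZ_resE modn_mod -padicZ_resE. Qed.

Lemma padicZ_res_le x n k : (x (n + k) %% p ^ n)%N = x n.
Proof.
elim: k => [|k IH]; first by rewrite addn0 padicZ_res_mod.
by rewrite -IH addnS [in RHS]padicZ_resE modn_dvdm // dvdn_exp2l ?leq_addr.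
Qed.

Lemma padicZ_of_subproof (f : nat -> nat) :
  (forall n, f n.+1 = f n %[mod p ^ n]) ->
  `[< padicZ_coherent p (fun n => f n %% p ^ n)%N >].
Proof.
move=> fE; apply/asboolP => n.
by rewrite modn_dvdm ?fE // dvdn_exp2l.
Qed.

Definition padicZ_of f fE : Z := MkPadicZ pr (@padicZ_of_subproof f fE).

Lemma padicZ_add_subproof x y n : (x n.+1 + y n.+1 = x n + y n %[mod p ^ n])%N.
Proof. by rewrite (padicZ_resE x n) (padicZ_resE y n) modnDm. Qed.
Definition padicZ_add x y := padicZ_of (padicZ_add_subproof x y).

Lemma padicZ_mul_subproof x y n : (x n.+1 * y n.+1 = x n * y n %[mod p ^ n])%N.
Proof. by rewrite (padicZ_resE x n) (padicZ_resE y n) modnMm. Qed.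
Definition padicZ_mul x y := padicZ_of (padicZ_mul_subproof x y).

Lemma padicZ_res_lt x n : (x n < p ^ n)%N.
Proof. by rewrite -padicZ_res_mod ltn_mod expn_gt0 prime_gt0. Qed.

Lemma padicZ_opp_subproof x n :
  (p ^ n.+1 - x n.+1 = p ^ n - x n %[mod p ^ n])%N.
Proof.
apply/eqP; rewrite -(eqn_modDr (x n)) subnK ?(ltnW (padicZ_res_lt _ _)) // modnn.
rewrite (padicZ_resE x n) modnDmr subnK ?(ltnW (padicZ_res_lt _ _)) //.
by rewrite expnS modnMl.
Qed.
Definition padicZ_opp x := padicZ_of (padicZ_opp_subproof x).

Definition padicZ_zero : Z := @padicZ_of (fun=> 0)%N (fun=> erefl).
Definition padicZ_one : Z := @padicZ_of (fun=> 1)%N (fun=> erefl).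

Lemma padicZ_addA : associative padicZ_add.
Proof. by move=> x y z; apply: padicZ_eq => n /=; rewrite modnDmr modnDml addnA. Qed.
Lemma padicZ_addC : commutative padicZ_add.
Proof. by move=> x y; apply: padicZ_eq => n /=; rewrite addnC. Qed.
Lemma padicZ_add0 : left_id padicZ_zero padicZ_add.
Proof. by move=> x; apply: padicZ_eq => n /=; rewrite mod0n padicZ_res_mod. Qed.
Lemma padicZ_addN : left_inverse padicZ_zero padicZ_opp padicZ_add.
Proof.
move=> x; apply: padicZ_eq => n /=.
by rewrite modnDml subnK ?modnn ?mod0n // ltnW // padicZ_res_lt.
Qed.
HB.instance Definition _ :=
  GRing.isZmodule.Build Z padicZ_addA padicZ_addC padicZ_add0 padicZ_addN.

Lemma padicZ_mulA : associative padicZ_mul.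
Proof. by move=> x y z; apply: padicZ_eq => n /=; rewrite modnMmr modnMml mulnA. Qed.
Lemma padicZ_mulC : commutative padicZ_mul.
Proof. by move=> x y; apply: padicZ_eq => n /=; rewrite mulnC. Qed.
Lemma padicZ_mul1 : left_id padicZ_one padicZ_mul.
Proof. by move=> x; apply: padicZ_eq => n /=; rewrite modnMml mul1n padicZ_res_mod. Qed.
Lemma padicZ_mulDl : left_distributive padicZ_mul padicZ_add.
Proof.
by move=> x y z; apply: padicZ_eq => n /=; rewrite modnMml modnDm mulnDl.
Qed.
Lemma padicZ_one_neq0 : padicZ_one != 0.
Proof.
apply/eqP => /(congr1 (fun x : Z => x 1%N)) /=.
by rewrite mod0n expn1 modn_small ?prime_gt1.
Qed.
HB.instance Definition _ := GRing.Zmodule_isComNzRing.Build Z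
  padicZ_mulA padicZ_mulC padicZ_mul1 padicZ_mulDl padicZ_one_neq0.

Lemma padicZ_res0 n : (0 : Z) n = 0%N. Proof. exact: mod0n. Qed.
Lemma padicZ_resD x y n : (x + y) n = ((x n + y n) %% p ^ n)%N. Proof. by []. Qed.
Lemma padicZ_resM x y n : (x * y) n = ((x n * y n) %% p ^ n)%N. Proof. by []. Qed.

Lemma padicZ_res_nat (k n : nat) : (k%:R : Z) n = (k %% p ^ n)%N.
Proof.
elim: k => [|k IH]; first by rewrite padicZ_res0 mod0n.
by rewrite -natr1 padicZ_resD IH /= modnDm addn1.
Qed.

Lemma padicZ_neq0P x : reflect (exists n, x n.+1 != 0%N) (x != 0).
Proof.
apply: (iffP idP) => [/eqP x0|[n xn]]; last first.
  by apply/eqP => x0; rewrite x0 padicZ_res0 in xn.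
apply: contrapT => /forallNP xn; apply/x0/padicZ_eq => -[|n].
  by rewrite padicZ_res0 -padicZ_res_mod expn0 modn1.
by rewrite padicZ_res0; apply/eqP/negPn/negP.
Qed.

(* The exponent of p in x, with the conventional value 0 at x = 0. *)
Definition padicZ_ord x : nat :=
  if pselect (exists n, x n.+1 != 0%N) is left h then ex_minn h else 0%N.

Lemma padicZ_ordP x n : x != 0 -> (x n == 0%N) = (n <= padicZ_ord x)%N.
Proof.
move=> /padicZ_neq0P x0; rewrite /padicZ_ord; case: pselect => // h.
case: ex_minnP => k xk kmin; apply/idP/idP => [/eqP xn|nk].
  rewrite leqNgt; apply/negP => kn.
  by move: xk; rewrite -(padicZ_res_le x k.+1 (n - k.+1)) subnKC // xn mod0n.
suff xk0 : x k = 0%N by rewrite -(padicZ_res_le x n (k - n)) subnKC // xk0 mod0n.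
case: k {xk nk} kmin => [_|k kmin]; first by rewrite -padicZ_res_mod expn0 modn1.
by apply/eqP/negPn/negP => /kmin; rewrite ltnn.
Qed.

Lemma padicZ_res_eq0 x n m : (n <= m)%N -> (x n == 0%N) = (p ^ n %| x m)%N.
Proof. by move=> nm; rewrite -(padicZ_res_le x n (m - n)) subnKC. Qed.

Lemma padicZ_ordM x y : x != 0 -> y != 0 ->
  x * y != 0 /\ padicZ_ord (x * y) = (padicZ_ord x + padicZ_ord y)%N.
Proof.
move=> x0 y0; set a := padicZ_ord x; set b := padicZ_ord y.
pose N := (a + b).+1.
have aN : (a.+1 <= N)%N by rewrite ltnS leq_addr.
have bN : (b.+1 <= N)%N by rewrite ltnS leq_addl.
have: (p ^ a %| x N)%N by rewrite -padicZ_res_eq0 ?padicZ_ordP // ltnW.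
have: ~~ (p ^ a.+1 %| x N)%N by rewrite -padicZ_res_eq0 ?padicZ_ordP ?ltnn.
have: (p ^ b %| y N)%N by rewrite -padicZ_res_eq0 ?padicZ_ordP // ltnW.
have: ~~ (p ^ b.+1 %| y N)%N by rewrite -padicZ_res_eq0 ?padicZ_ordP ?ltnn.
move=> /[swap] /dvdnP[v yE] + /[swap] /dvdnP[u xE].
rewrite yE xE !expnS !dvdn_pmul2r ?expn_gt0 ?prime_gt0 // => pv pu.
have xyE : (x N * y N = (u * v) * p ^ (a + b))%N.
  by rewrite xE yE mulnACA expnD.
have xyN : (x * y) N != 0%N.
  rewrite padicZ_resM xyE -/(dvdn _ _) /N expnS.
  by rewrite dvdn_pmul2r ?expn_gt0 ?prime_gt0 // Euclid_dvdM // negb_or pu.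
have xy0 : x * y != 0 by apply/padicZ_neq0P; exists (a + b)%N.
split=> //; apply/eqP; rewrite eqn_leq -(padicZ_ordP _ xy0).
rewrite leqNgt -(padicZ_ordP _ xy0) xyN (@padicZ_res_eq0 _ _ N) ?leqnSn //=.
by rewrite /dvdn modn_dvdm ?dvdn_exp2l // xyE modnMl.
Qed.

Lemma padicZ_idomain : GRing.integral_domain_axiom Z.
Proof.
move=> x y /eqP; apply: contraTT; rewrite negb_or => /andP[x0 y0].
by have [] := padicZ_ordM x0 y0.
Qed.

(* Units are decided classically. *)
Definition padicZ_unit : pred Z := fun x => `[< exists y, y * x = 1 >].
Definition padicZ_inv x : Z :=
  if pselect (exists y, y * x = 1) is left h then projT1 (cid h) else x.

Lemma padicZ_mulVx : {in padicZ_unit, left_inverse 1 padicZ_inv *%R}.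
Proof.
move=> x /asboolP ux; rewrite /padicZ_inv.
by case: pselect => // h; case: (cid h).
Qed.
Lemma padicZ_unitPl x y : y * x = 1 -> padicZ_unit x.
Proof. by move=> yx; apply/asboolP; exists y. Qed.
Lemma padicZ_inv_out : {in [predC padicZ_unit], padicZ_inv =1 id}.
Proof.
move=> x /asboolPn ux; rewrite /padicZ_inv.
by case: pselect.
Qed.
HB.instance Definition _ := GRing.ComNzRing_hasMulInverse.Build Z
  padicZ_mulVx padicZ_unitPl padicZ_inv_out.
HB.instance Definition _ := GRing.ComUnitRing_isIntegral.Build Z padicZ_idomain.

End ZpRing.

Notation padicQ pr := {fraction (padicZ pr)}.

Notation padicZ_to_padicQ := (@FracField.tofrac (padicZ _)).

Lemma frac_repr (D : idomainType) (x : {fraction D}) :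
  x = FracField.tofrac \n_(repr x) / FracField.tofrac \d_(repr x).
Proof.
have d0 := denom_ratioP (repr x).
apply: (canRL (mulfK _)); first by rewrite tofrac_eq0 d0.
rewrite -{1}[x]reprK; set r := repr x in d0 *.
rewrite !/FracField.tofrac; unlock FracField.tofrac.
rewrite -[LHS]FracField.pi_mul; apply/eqP.
rewrite FracField.equivf_def /FracField.mulf.
by rewrite !numden_Ratio ?mulr1 ?oner_neq0 // mulrC.
Qed.

Record nonarch_abs (R : realType) (K : fieldType) (v : K -> R) : Prop := {
  nonarch_abs_ge0 : forall x, 0 <= v x;
  nonarch_abs_eq0 : forall x, v x = 0 <-> x = 0;
  nonarch_absM : forall x y, v (x * y) = v x * v y;
  nonarch_absD : forall x y, v (x + y) <= Num.max (v x) (v y) }.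

Section AbsoluteValue.
Variables (p : nat) (pr : prime p) (R : realType).

Definition padicZ_abs (x : padicZ pr) : R :=
  if x == 0 then 0 else p%:R ^- padicZ_ord x.

(* Independent of the chosen fraction: see padicQ_abs_div. *)
Definition padicQ_abs (x : padicQ pr) : R :=
  padicZ_abs \n_(repr x) / padicZ_abs \d_(repr x).

Lemma padicZ_absM : {morph padicZ_abs : x y / x * y}.
Proof.
move=> x y; rewrite /padicZ_abs mulf_eq0.
have [->|x0] := eqVneq x 0; first by rewrite /= mul0r.
have [->|y0] := eqVneq y 0; first by rewrite orbT mulr0.
by have [_ ->] := padicZ_ordM x0 y0; rewrite /= exprD invfM.
Qed.

Let p_gt0 : 0 < p%:R :> R. Proof. by rewrite ltr0n prime_gt0. Qed.

Lemma padicZ_abs_ge0 x : 0 <= padicZ_abs x.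
Proof. by rewrite /padicZ_abs; case: ifP; rewrite // invr_ge0 exprn_ge0 // ltW. Qed.

Lemma padicZ_abs_eq0 x : (padicZ_abs x == 0) = (x == 0).
Proof.
rewrite /padicZ_abs; case: ifP => [|_]; first by rewrite eqxx.
by rewrite invr_eq0 expf_eq0 gt_eqF // andbF.
Qed.

Lemma padicZ_abs_le x n : (padicZ_abs x <= p%:R ^- n) = (x n == 0%N).
Proof.
rewrite /padicZ_abs; case: ifPn => [/eqP->|x0].
  by rewrite padicZ_res0 invr_ge0 exprn_ge0 // ltW.
rewrite padicZ_ordP // lef_pV2 ?posrE ?exprn_gt0 //.
by rewrite ler_eXn2l // ltr1n prime_gt1.
Qed.

Lemma padicZ_absD x y :
  padicZ_abs (x + y) <= Num.max (padicZ_abs x) (padicZ_abs y).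
Proof.
have [->|x0] := eqVneq x 0; first by rewrite add0r le_max lexx orbT.
have [->|y0] := eqVneq y 0; first by rewrite addr0 le_max lexx.
have absE z : z != 0 -> padicZ_abs z = p%:R ^- padicZ_ord z.
  by rewrite /padicZ_abs => /negPf->.
have main (u w : padicZ pr) n : padicZ_abs u <= p%:R ^- n ->
    padicZ_abs w <= p%:R ^- n -> padicZ_abs (u + w) <= p%:R ^- n.
  by rewrite !padicZ_abs_le padicZ_resD => /eqP-> /eqP->; rewrite mod0n.
have [xy|yx] := lerP (padicZ_abs x) (padicZ_abs y).
  by rewrite (absE y) //; apply: main; rewrite -?(absE y).
by rewrite (absE x) //; apply: main; rewrite -?(absE x) // ltW.
Qed.

Lemma padicQ_abs_div (a b : padicZ pr) : b != 0 ->
  padicQ_abs (padicZ_to_padicQ a / padicZ_to_padicQ b) =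
  padicZ_abs a / padicZ_abs b.
Proof.
move=> b0; rewrite /padicQ_abs; set x := (X in repr X).
have d0 := denom_ratioP (repr x).
have /eqP : padicZ_to_padicQ a / padicZ_to_padicQ b =
  padicZ_to_padicQ \n_(repr x) / padicZ_to_padicQ \d_(repr x).
  exact: frac_repr.
rewrite eqr_div ?tofrac_eq0 // -!tofracM tofrac_eq => /eqP E.
apply/eqP; rewrite eqr_div ?padicZ_abs_eq0 // -!padicZ_absM.
by rewrite -E mulrC.
Qed.

Lemma padicQ_abs_nonarch : nonarch_abs padicQ_abs.
Proof.
have fracP (x : padicQ pr) : exists a b : padicZ pr,
    b != 0 /\ x = padicZ_to_padicQ a / padicZ_to_padicQ b.
  exists \n_(repr x), \d_(repr x); split; last exact: frac_repr.
  exact: denom_ratioP.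
have toE (a : padicZ pr) : (padicZ_to_padicQ a == 0) = (a == 0).
  exact: tofrac_eq0.
have toM (a b : padicZ pr) : padicZ_to_padicQ (a * b) =
    padicZ_to_padicQ a * padicZ_to_padicQ b by exact: tofracM.
have toD (a b : padicZ pr) : padicZ_to_padicQ (a + b) =
    padicZ_to_padicQ a + padicZ_to_padicQ b by exact: tofracD.
split.
- by move=> x; rewrite /padicQ_abs divr_ge0 // padicZ_abs_ge0.
- move=> x; have [a [b [b0 ->]]] := fracP x.
  rewrite padicQ_abs_div //; split=> /eqP.
    rewrite mulf_eq0 invr_eq0 !padicZ_abs_eq0 (negPf b0) orbF => /eqP->.
    by rewrite tofrac0 mul0r.
  rewrite mulf_eq0 invr_eq0 !toE (negPf b0) orbF => a0.
  by apply/eqP; rewrite mulf_eq0 padicZ_abs_eq0 a0.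
- move=> x y; have [a [b [b0 ->]]] := fracP x.
  have [c [d [d0 ->]]] := fracP y.
  rewrite mulf_div -!toM !padicQ_abs_div ?mulf_neq0 //.
  by rewrite !padicZ_absM mulf_div.
- move=> x y; have [a [b [b0 ->]]] := fracP x.
  have [c [d [d0 ->]]] := fracP y.
  rewrite addf_div ?toE // -!toM -toD !padicQ_abs_div ?mulf_neq0 //.
  have bd0 : 0 < padicZ_abs (b * d).
    by rewrite lt0r padicZ_abs_eq0 mulf_neq0 // padicZ_abs_ge0.
  rewrite ler_pdivrMr // maxr_pMl ?(ltW bd0) //.
  have -> : padicZ_abs a / padicZ_abs b * padicZ_abs (b * d) =
            padicZ_abs (a * d).
    by rewrite !padicZ_absM mulrA divfK // padicZ_abs_eq0.
  have -> : padicZ_abs c / padicZ_abs d * padicZ_abs (b * d) =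
            padicZ_abs (c * b).
    rewrite !padicZ_absM [padicZ_abs b * _]mulrC mulrA divfK //.
    by rewrite padicZ_abs_eq0.
  exact: padicZ_absD.
Qed.

End AbsoluteValue.

(* K, with the absolute value v and the embedding iota, is a valued field
   extension of Q_p.  Both Q_p itself (see padicQ_extension) and C_p, the
   completion of an algebraic closure of Q_p, are of this form. *)
Record padic_extension (p : nat) (pr : prime p) (R : realType)
    (K : fieldType) (v : K -> R) (iota : {rmorphism padicQ pr -> K}) : Prop := {
  padic_ext_abs : nonarch_abs v;
  padic_ext_isometry : forall x, v (iota x) = padicQ_abs R x }.

Lemma padicQ_extension (p : nat) (pr : prime p) (R : realType) :
  padic_extension (@padicQ_abs p pr R) idfun.
Proof. by split=> //; exact: padicQ_abs_nonarch. Qed.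

Definition fermionic_sum (p : nat) (pr : prime p) (K : fieldType)
    (f : padicZ pr -> K) (N : nat) : K :=
  \sum_(0 <= x < p ^ N) f x%:R * (-1) ^+ x.

(* The limit defining the fermionic p-adic integral of f exists in (K, v) and
   is equal to l. *)
Definition has_fermionic_integral (p : nat) (pr : prime p) (R : realType)
    (K : fieldType) (v : K -> R) (f : padicZ pr -> K) (l : K) : Prop :=
  ((fun N : nat => v (fermionic_sum f N - l)) @ \oo --> (0 : R))%classic.

(* For n < k the binomial coefficient, hence the polynomial, is 0. *)
Definition bernstein (A : comNzRingType) (k n : nat) : {poly A} :=
  'C(n, k)%:R *: ('X^k * (1 - 'X) ^+ (n - k)).

(* Formal power series are represented by their sequences of coefficients. *)
Section FormalPowerSeries.
Variable F : fieldType.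
Implicit Types a b : nat -> F.

Definition fps_const (c : F) : nat -> F := fun n => if n == 0%N then c else 0.

Definition fps_exp : nat -> F := fun n => n`!%:R^-1.

Definition fps_add a b : nat -> F := fun n => a n + b n.

Definition fps_mul a b : nat -> F := fun n => \sum_(i < n.+1) a i * b (n - i)%N.

(* The first n coefficients of 1 / a, for a with nonzero constant term: see
   fps_mulV. *)
Fixpoint fps_inv_seq a (n : nat) : seq F :=
  if n is m.+1 then
    let s := fps_inv_seq a m in
    rcons s ((a 0%N)^-1 * (fps_const 1 m - \sum_(j < m) a (m - j)%N * s`_j))
  else [::].

Definition fps_inv a : nat -> F := fun n => (fps_inv_seq a n.+1)`_n.

Lemma size_fps_inv_seq a n : size (fps_inv_seq a n) = n.
Proof. by elim: n => //= n IH; rewrite size_rcons IH. Qed.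

Lemma nth_fps_inv_seq a n j : (j < n)%N -> (fps_inv_seq a n)`_j = fps_inv a j.
Proof.
elim: n => //= n IH; rewrite ltnS leq_eqVlt => /predU1P[->|jn].
  by rewrite /fps_inv.
by rewrite nth_rcons size_fps_inv_seq jn IH.
Qed.

Lemma fps_mulV a : a 0%N != 0 -> fps_mul a (fps_inv a) =1 fps_const 1.
Proof.
move=> a0 n; rewrite /fps_mul (reindex_inj rev_ord_inj) big_ord_recr /=.
rewrite subSS subnn subn0 {2}/fps_inv /= nth_rcons size_fps_inv_seq ltnn eqxx.
rewrite mulVKf // addrC -addrA -[RHS]addr0; congr (_ + _).
rewrite addrC; apply/eqP; rewrite subr_eq0; apply/eqP/eq_bigr => i _ /=.
by rewrite subSS subKn ?nth_fps_inv_seq // ltnW.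
Qed.

End FormalPowerSeries.

(* E_n / n! is the coefficient of t^n in 2 / (e^t + 1). *)
Definition euler (n : nat) : rat :=
  n`!%:R * fps_mul (fps_const 2%:R)
             (fps_inv (fps_add (fps_exp rat) (fps_const 1))) n.

(* Main.v *)
(* If F is a rational polynomial and f(x) = (F(x) + F(x+1)) / 2 on the naturals,
   then for odd L the alternating sum of f over [0, L) telescopes to
   (F(0) + F(L)) / 2.  With L = p^N -> 0 this tends to F(0).  The Euler
   polynomial E_n(x) solves E_n(x) + E_n(x+1) = 2 x^n, hence x |-> E_n(2-x)
   solves the same equation for 2 (1-x)^n, and its value at 0 is
   E_n(2) = 2 + E_n for n > 0.  The product of Bernstein polynomials is a
   multiple of x^T (1-x)^(M-T), which is expanded in powers of 1-x; for T > 0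
   the contributions of the constant 2 cancel since (1-1)^T = 0. *)
From HB Require Import structures.
Require Import Defs.
From mathcomp Require Import all_boot all_order all_algebra.
From mathcomp Require Import reals topology normedtype sequences ring.

Set Implicit Arguments.
Unset Strict Implicit.
Unset Printing Implicit Defensive.

Import Order.TTheory GRing.Theory Num.Theory.
Import numFieldNormedType.Exports.
Local Open Scope ring_scope.

(** * Euler numbers, Euler polynomials and alternating sums *)

(** This compares coefficients of t^n in (e^t + 1) times the generating series, which equals 2,
    after multiplying by n!. *)
Lemma euler_rec (n : nat) :
  \sum_(i < n.+1) 'C(n, i)%:R * euler i + euler n = 2%:R * (n == 0%N)%:R.
Proof.
set a := fps_add (fps_exp rat) (fps_const 1).
have eE i : euler i = i`!%:R * (2%:R * fps_inv a i).
  rewrite /euler; congr (_ * _); rewrite /fps_mul big_ord_recl subn0 /=.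
  by rewrite big1 ?addr0 // => j _; rewrite /fps_const /= mul0r.
have a0 : a 0%N != 0 by rewrite /a /fps_add /fps_exp /fps_const fact0.
have := congr1 (fun x => n`!%:R * (2%:R * x)) (fps_mulV a0 n).
rewrite /fps_mul {1}(reindex_inj rev_ord_inj) /=.
under eq_bigr => i _ do
  rewrite subSS subKn ?leq_ord // /a /fps_add mulrDl.
(* The summand 1 of e^t + 1 contributes only at i = n; this gives the isolated [euler n]. *)
rewrite big_split /= [X in _ + X]big_ord_recr /= [X in _ + (X + _)]big1; last first.
  by move=> i _; rewrite /fps_const subn_eq0 leqNgt ltn_ord mul0r.
rewrite add0r subnn {1}/fps_const /= mul1r => E.
transitivity (n`!%:R * (2%:R * fps_const (1 : rat) n)); last first.
  rewrite /fps_const; case: n {E} => [|n] /=; first by rewrite fact0 !mulr1 mul1r.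
  by rewrite !mulr0.
rewrite -E [in euler n]eE !mulrDr; congr (_ + _).
rewrite !mulr_sumr; apply: eq_bigr => i _; rewrite eE.
have /(congr1 (fun m => m%:R : rat)) := bin_fact (leq_ord i).
rewrite !natrM => <-.
rewrite /fps_exp; set b := fps_inv a i; field.
by rewrite pnatr_eq0 -lt0n fact_gt0.
Qed.

(** The classical Euler polynomial E_n(x), with generating series 2 e^(xt) / (e^t + 1). *)
Definition euler_poly (n : nat) : {poly rat} :=
  \poly_(i < n.+1) ('C(n, i)%:R * euler (n - i)).

Lemma deriv_euler_poly (n : nat) :
  (euler_poly n)^`() = n%:R *: euler_poly n.-1.
Proof.
apply/polyP => i; rewrite coef_deriv coefZ !coef_poly.
case: n => [|n]; first by rewrite /= mul0rn mul0r.
rewrite ltnS /=; case: ifP => _; last by rewrite mul0rn mulr0.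
rewrite subSS; move: (euler _) => e.
by rewrite -mulrnAl -mulrnA mulrA -natrM (mul_bin_diag n.+1) mulnC.
Qed.

Lemma horner0_euler_poly (n : nat) : (euler_poly n).[0] = euler n.
Proof. by rewrite horner_coef0 coef_poly bin0 mul1r subn0. Qed.

Lemma horner1_euler_poly (n : nat) :
  (euler_poly n).[1] = \sum_(i < n.+1) 'C(n, i)%:R * euler i.
Proof.
rewrite horner_poly (reindex_inj rev_ord_inj); apply: eq_bigr => i _ /=.
by rewrite subSS subKn ?leq_ord // bin_sub ?leq_ord // expr1n mulr1.
Qed.

Lemma deriv_eq0 (q : {poly rat}) : q^`() = 0 -> q.[0] = 0 -> q = 0.
Proof.
move=> dq; rewrite horner_coef0 => q0; apply/polyP => -[|i]; rewrite coef0 //.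
have /(congr1 (fun r : {poly rat} => r`_i)) := dq.
by rewrite coef_deriv coef0 => /eqP; rewrite mulrn_eq0 /= => /eqP.
Qed.

(** Induction on n: the derivative of the identity for n+1 is n+1 times the identity for n, and the
    values at 0 agree by [euler_rec]. *)
Lemma euler_poly_shift (n : nat) :
  euler_poly n + (euler_poly n \Po ('X + 1)) = 2%:R *: 'X^n.
Proof.
apply/eqP; rewrite -subr_eq0; apply/eqP.
elim: n => [|n IH]; apply: deriv_eq0.
- rewrite derivB derivD deriv_comp derivZ derivXn !deriv_euler_poly.
  by rewrite !scale0r comp_poly0 mul0r mulr0n scaler0 addr0 subr0.
- rewrite hornerD hornerN hornerZ hornerXn hornerD horner_comp hornerD hornerX.
  rewrite hornerC add0r horner0_euler_poly horner1_euler_poly.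
  by rewrite [euler 0 + _]addrC euler_rec mulr1 subrr.
- rewrite derivB derivD deriv_comp derivZ derivXn !deriv_euler_poly /=.
  rewrite derivD derivX derivC addr0 mulr1 comp_polyZ -scaler_nat.
  rewrite [2%:R *: _]scalerA [2%:R * _]mulrC -scalerA -scalerDr -scalerBr.
  by rewrite IH scaler0.
- rewrite hornerD hornerN hornerZ hornerXn hornerD horner_comp hornerD hornerX.
  rewrite hornerC add0r horner0_euler_poly horner1_euler_poly.
  by rewrite [euler _ + _]addrC euler_rec mulr0 expr0n mulr0 subrr.
Qed.

Lemma horner_euler_polyD1 (n : nat) (x : rat) :
  (euler_poly n).[x] + (euler_poly n).[x + 1] = 2%:R * x ^+ n.
Proof.
have /(congr1 (fun r : {poly rat} => r.[x])) := euler_poly_shift n.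
by rewrite hornerD horner_comp hornerD hornerX hornerC hornerZ hornerXn.
Qed.

(** The functional equation at 0 gives E_n(1) = - E_n, since 0^n = 0 for n > 0; at 1 it gives E_n(1)
    + E_n(2) = 2. *)
Lemma horner2_euler_poly (n : nat) :
  (0 < n)%N -> (euler_poly n).[2%:R] = 2%:R + euler n.
Proof.
move=> n0; have := horner_euler_polyD1 n 1; have := horner_euler_polyD1 n 0.
rewrite horner0_euler_poly add0r expr0n gtn_eqF // expr1n -[1 + 1]/(2%:R).
move=> /eqP; rewrite mulr0 addr_eq0 => /eqP ->.
by rewrite mulr1 => e1E; rewrite -[2%:R in RHS]e1E [RHS]addrAC subrr add0r.
Qed.

Lemma alternating_sum_odd (A : comNzRingType) (f : nat -> A) (n : nat) :
  odd n -> \sum_(0 <= x < n) (f x + f x.+1) * (-1) ^+ x = f 0%N + f n.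
Proof.
move=> n_odd; suff -> : \sum_(0 <= x < n) (f x + f x.+1) * (-1) ^+ x =
    f 0%N - (-1) ^+ n * f n by rewrite -signr_odd n_odd expr1 mulN1r opprK.
elim: n {n_odd} => [|n IH]; first by rewrite big_geq // mul1r subrr.
by rewrite big_nat_recr //= IH exprS; ring.
Qed.

(** * Polynomials under a nonarchimedean absolute value *)

Section NonarchAbs.
Variables (R : realType) (K : fieldType) (v : K -> R).
Hypothesis v_abs : nonarch_abs v.

Lemma nonarch_abs1 : v 1 = 1.
Proof.
have v1 : v 1 != 0.
  by apply/eqP => /(nonarch_abs_eq0 v_abs)/eqP; rewrite oner_eq0.
by apply: (mulfI v1); rewrite -(nonarch_absM v_abs) !mulr1.
Qed.

Lemma nonarch_absX (x : K) (n : nat) : v (x ^+ n) = v x ^+ n.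
Proof.
elim: n => [|n IH]; first exact: nonarch_abs1.
by rewrite !exprS (nonarch_absM v_abs) IH.
Qed.

Lemma nonarch_abs_triangle (x y : K) : v (x + y) <= v x + v y.
Proof.
apply: le_trans (nonarch_absD v_abs x y) _.
by rewrite ge_max lerDl lerDr !(nonarch_abs_ge0 v_abs).
Qed.

Lemma nonarch_abs_horner_le (q : {poly K}) :
  exists2 B : R, 0 <= B & forall x, v x <= 1 -> v q.[x] <= B.
Proof.
elim/poly_ind: q => [|q c [B B0 qB]].
  exists 0 => // x _; rewrite horner0.
  by rewrite (nonarch_abs_eq0 v_abs 0).2.
exists (B + v c) => [|x x1]; first by rewrite addr_ge0 // (nonarch_abs_ge0 v_abs).
rewrite hornerMXaddC (le_trans (nonarch_abs_triangle _ _)) // lerD2r.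
rewrite (nonarch_absM v_abs) -[B]mulr1.
by rewrite ler_pM ?(nonarch_abs_ge0 v_abs) ?qB.
Qed.

(** For q X + c the difference is q(x) x, and q is bounded on the unit ball. This is continuity at 0
    with an explicit rate. *)
Lemma nonarch_abs_horner_sub (q : {poly K}) :
  exists2 B : R, 0 <= B & forall x, v x <= 1 -> v (q.[x] - q.[0]) <= B * v x.
Proof.
elim/poly_ind: q => [|q c _].
  exists 0 => // x _; rewrite !horner0 subrr mul0r.
  by rewrite (nonarch_abs_eq0 v_abs 0).2.
have [B B0 qB] := nonarch_abs_horner_le q; exists B => // x x1.
rewrite !hornerMXaddC mulr0 add0r addrK (nonarch_absM v_abs).
by rewrite ler_wpM2r ?qB ?(nonarch_abs_ge0 v_abs).
Qed.

End NonarchAbs.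

(** * Rational numbers in a field of characteristic 0 *)

Section RatrMorphism.
Variables (F : fieldType) (F0 : forall n : nat, n.+1%:R != 0 :> F).

Lemma intr_neq0 (z : int) : z != 0 -> z%:~R != 0 :> F.
Proof.
case: z => [[|n]|n] //= _; first exact: F0.
by rewrite NegzE mulrNz oppr_eq0 F0.
Qed.

(** [ratr] is defined by the reduced fraction; this allows any fraction. Cross-multiplying leaves an
    identity of integers, which transfers from [rat] to [F]. *)
Lemma ratr_mulr_intr (x : rat) (a b : int) :
  x * b%:~R = a%:~R -> ratr x * b%:~R = a%:~R :> F.
Proof.
move=> xE; have dx : (denq x)%:~R != 0 :> F by apply/intr_neq0/denq_neq0.
rewrite /ratr mulrAC; apply: (canLR (mulfK dx)).
rewrite -!intrM; congr _%:~R; apply: (@intr_inj rat).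
by rewrite !intrM numqE -xE mulrAC.
Qed.

(* MathComp's ratr is a morphism only into a numFieldType. *)
Lemma ratr_additive : zmod_morphism (ratr : rat -> F).
Proof.
move=> x y; set dx := denq x; set dy := denq y.
have d0 : (dx * dy)%:~R != 0 :> F by rewrite intr_neq0 // mulf_neq0 ?denq_neq0.
apply: (mulIf d0).
have dxE := ratr_mulr_intr (esym (numqE x)).
have dyE := ratr_mulr_intr (esym (numqE y)).
rewrite (@ratr_mulr_intr _ (numq x * dy - numq y * dx) (dx * dy)).
  by rewrite rmorphB !rmorphM /= -dxE -dyE; ring.
by rewrite rmorphB !rmorphM /= !numqE; ring.
Qed.

Lemma ratr_multiplicative : monoid_morphism (ratr : rat -> F).
Proof.
split=> [|x y]; first exact: (ratr_nat _ 1).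
set dx := denq x; set dy := denq y.
have d0 : (dx * dy)%:~R != 0 :> F by rewrite intr_neq0 // mulf_neq0 ?denq_neq0.
apply: (mulIf d0).
have dxE := ratr_mulr_intr (esym (numqE x)).
have dyE := ratr_mulr_intr (esym (numqE y)).
rewrite (@ratr_mulr_intr _ (numq x * numq y) (dx * dy)).
  by rewrite !rmorphM /= -dxE -dyE; ring.
by rewrite !rmorphM /= !numqE; ring.
Qed.

Lemma ratr_rmorphism : exists phi : {rmorphism rat -> F}, phi =1 ratr.
Proof.
pose phiZ := GRing.isZmodMorphism.Build rat F ratr ratr_additive.
pose phiM := GRing.isMonoidMorphism.Build rat F ratr ratr_multiplicative.
pose phi : {rmorphism rat -> F} := HB.pack (ratr : rat -> F) phiZ phiM.
by exists phi.
Qed.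

End RatrMorphism.

(** Since n+1 < p^(n+1), the residue of n+1 modulo p^(n+1) is n+1 itself, which is nonzero. *)
Lemma padicQ_natr_neq0 (p : nat) (pr : prime p) (n : nat) :
  n.+1%:R != 0 :> padicQ pr.
Proof.
rewrite -(rmorph_nat (@FracField.tofrac (padicZ pr))) tofrac_eq0.
apply/padicZ_neq0P; exists n; rewrite padicZ_res_nat modn_small //.
exact/ltn_expl/prime_gt1.
Qed.

(** * The fermionic integral as a p-adic limit *)

Section PadicRat.
Variables (p : nat) (pr : prime p) (R : realType) (K : fieldType).
Variables (v : K -> R) (iota : {rmorphism padicQ pr -> K}).
Hypothesis K_ext : padic_extension v iota.

Lemma padic_ext_natr_le1 (n : nat) : v n%:R <= 1.
Proof.
have v_abs := padic_ext_abs K_ext.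
elim: n => [|n IH]; first by rewrite (nonarch_abs_eq0 v_abs 0).2.
rewrite -natr1 (le_trans (nonarch_absD v_abs _ _)) // ge_max IH.
by rewrite (nonarch_abs1 v_abs) lexx.
Qed.

Lemma padic_ext_p_lt1 : v p%:R < 1.
Proof.
have abs_natr n : v n%:R =
    padicZ_abs R (n%:R : padicZ pr) / padicZ_abs R (1 : padicZ pr).
  rewrite -padicQ_abs_div ?oner_neq0 // tofrac1 divr1 -(padic_ext_isometry K_ext).
  by rewrite !rmorph_nat.
have z1 : padicZ_abs R (1 : padicZ pr) = 1.
  have z0 : padicZ_abs R (1 : padicZ pr) != 0.
    by rewrite padicZ_abs_eq0 oner_neq0.
  by apply: (mulfI z0); rewrite -padicZ_absM !mulr1.
rewrite abs_natr z1 divr1; apply: (@le_lt_trans _ _ (p%:R ^- 1)).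
  by rewrite padicZ_abs_le padicZ_res_nat expn1 modnn.
by rewrite expr1 invf_lt1 ?ltr1n ?ltr0n ?prime_gt1 ?prime_gt0.
Qed.

(** The fermionic sums see [f] only at naturals. By telescoping, the N-th sum differs from F(0) by
    (F(p^N) - F(0)) / 2, which is at most a constant times v(p)^N. *)
Lemma has_fermionic_integral_half_shift (p_odd : odd p) (F : {poly rat})
    (f : padicZ pr -> K) :
  (forall x : nat, f x%:R = iota (ratr ((F.[x%:R] + F.[x.+1%:R]) / 2%:R))) ->
  has_fermionic_integral v f (iota (ratr F.[0])).
Proof.
move=> fE; have v_abs := padic_ext_abs K_ext.
have [phi phiE] := ratr_rmorphism (padicQ_natr_neq0 pr).
pose psi : {rmorphism rat -> K} := iota \o phi.
have psiE x : iota (ratr x) = psi x by rewrite -phiE.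
(* Transporting F to K along [psi] makes the bound near 0 available at the points p^N. *)
have [B B0 FB] := nonarch_abs_horner_sub v_abs (map_poly psi F).
have sumE N : fermionic_sum f N - iota (ratr F.[0]) =
    psi (2%:R^-1) * ((map_poly psi F).[p%:R ^+ N] - (map_poly psi F).[0]).
  have -> : fermionic_sum f N =
      psi (2%:R^-1 * \sum_(0 <= x < p ^ N) (F.[x%:R] + F.[x.+1%:R]) * (-1) ^+ x).
    rewrite mulr_sumr rmorph_sum; apply: eq_bigr => x _.
    rewrite fE psiE [in RHS]mulrA [2%:R^-1 * _]mulrC [RHS]rmorphM.
    by rewrite rmorphXn rmorphN rmorph1.
  rewrite (alternating_sum_odd (fun x => F.[x%:R])) ?oddX ?p_odd ?orbT //.
  rewrite natrX psiE.
  have -> : p%:R ^+ N = psi (p%:R ^+ N) by rewrite rmorphXn rmorph_nat.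
  rewrite -(rmorph0 psi) !horner_map -!rmorphB -rmorphM; congr (psi _).
  by field.
apply: (squeeze_cvgr (f := fun=> 0)
  (h := fun N => v (psi 2%:R^-1) * B * v p%:R ^+ N)).
- near=> N; rewrite (nonarch_abs_ge0 v_abs) /= sumE (nonarch_absM v_abs) -mulrA.
  rewrite ler_wpM2l ?(nonarch_abs_ge0 v_abs) // -(nonarch_absX v_abs) FB //.
  by rewrite -natrX padic_ext_natr_le1.
- exact: cvg_cst.
- rewrite -(mulr0 (v (psi 2%:R^-1) * B)); apply: cvgMl_tmp; apply: cvg_expr.
  by rewrite ger0_norm ?(nonarch_abs_ge0 v_abs) ?padic_ext_p_lt1.
Unshelve. all: by end_near.
Qed.

End PadicRat.

(** * Reflected Euler polynomials and products of Bernstein polynomials *)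

(** The coefficients are those of x^T = (1 - (1-x))^T in powers of 1-x; each (1-x)^(M-j) in x^T
    (1-x)^(M-T) is replaced by E_(M-j)(2-x). *)
Definition mirror_euler_poly (T M : nat) : {poly rat} :=
  \sum_(0 <= j < T.+1)
    ('C(T, j)%:R * (-1) ^+ (T - j)) *: (euler_poly (M - j) \Po (2%:R%:P - 'X)).

Lemma mirror_euler_poly_shift (T M : nat) (x : rat) : (T <= M)%N ->
  (mirror_euler_poly T M).[x] + (mirror_euler_poly T M).[x + 1] =
  2%:R * (x ^+ T * (1 - x) ^+ (M - T)).
Proof.
move=> TM; rewrite !horner_sum -big_split /=.
transitivity (\sum_(i < T.+1) 2%:R * (1 - x) ^+ (M - T) *
   (((-1) ^+ (T - i) * (1 - x) ^+ (T - i) * 1 ^+ i) *+ 'C(T, i))).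
  rewrite big_mkord; apply: eq_bigr => -[j /= jT] _.
  rewrite !hornerZ !horner_comp !hornerD !hornerN !hornerX !hornerC -mulrDr addrC.
  (* Reflection swaps the two terms: the functional equation is used at 2 - (x+1) = 1 - x. *)
  have -> : 2%:R - x = (2%:R - (x + 1)) + 1 by ring.
  rewrite horner_euler_polyD1.
  have -> : 2%:R - (x + 1) = 1 - x by ring.
  have -> : (M - j = (M - T) + (T - j))%N by rewrite addnBA // subnK.
  by rewrite expr1n exprD -mulr_natl; ring.
rewrite -mulr_sumr; under eq_bigr => i _ do rewrite -exprMn.
rewrite -exprDn; have -> : -1 * (1 - x) + 1 = x by ring.
by ring.
Qed.

(** The strict inequality keeps every index M - j positive, as the value E_n(2) = 2 + E_n
    requires. *)
Lemma horner0_mirror_euler_poly (T M : nat) : (T < M)%N ->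
  (mirror_euler_poly T M).[0] =
  \sum_(0 <= j < T.+1) 'C(T, j)%:R * (-1) ^+ (T - j) * (2%:R + euler (M - j)).
Proof.
move=> TM; rewrite horner_sum; apply: eq_big_nat => j /andP[_ jT].
rewrite hornerZ horner_comp hornerD hornerN hornerX hornerC subr0.
by rewrite horner2_euler_poly // subn_gt0 (leq_trans _ TM).
Qed.

Lemma sum_signed_binomials (T : nat) : (0 < T)%N ->
  \sum_(0 <= j < T.+1) 'C(T, j)%:R * (-1) ^+ (T - j) = 0 :> rat.
Proof.
move=> T0; transitivity ((-1 + 1 : rat) ^+ T); last first.
  by rewrite addNr expr0n gtn_eqF.
rewrite exprDn big_mkord.
by apply: eq_bigr => i _; rewrite expr1n mulr1 mulr_natl.
Qed.

(** The exponents of 1-x add up only if no [n i - k] with [m i > 0] is truncated; otherwise a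
    vanishing binomial coefficient makes both sides 0. *)
Lemma prod_bernstein (s : nat) (m n : 'I_s -> nat) (k : nat) (x : rat) :
  \prod_(i < s) (bernstein rat k (n i)).[x] ^+ m i =
  (\prod_(i < s) 'C(n i, k)%:R ^+ m i) *
  (x ^+ (k * \sum_(i < s) m i) *
   (1 - x) ^+ (\sum_(i < s) m i * n i - k * \sum_(i < s) m i)).
Proof.
have bE i : (bernstein rat k (n i)).[x] =
    'C(n i, k)%:R * (x ^+ k * (1 - x) ^+ (n i - k)).
  by rewrite hornerZ hornerM hornerXn horner_exp hornerD hornerN hornerX hornerC.
have [/forallP kn|] := boolP [forall i, (k <= n i)%N || (m i == 0%N)]; last first.
  (* Some truncated n i - k occurs with m i > 0: both sides are 0. *)
  rewrite negb_forall => /existsP[i]; rewrite negb_or -ltnNge => /andP[nk mi].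
  rewrite (bigD1 i) //= (bigD1 (R := rat) i (P := xpredT)) //=.
  by rewrite bE bin_small // !mul0r expr0n (negPf mi) !mul0r.
under eq_bigr => i _ do rewrite bE !exprMn.
rewrite !big_split /=; congr (_ * (_ * _)).
  under eq_bigr => i _ do rewrite -exprM.
  by rewrite -expr_sum big_distrr.
under eq_bigr => i _ do rewrite -exprM.
rewrite -expr_sum big_distrr /= -sumnB => [|i _]; last first.
  by have /orP[?|/eqP->] := kn i; rewrite ?muln0 // mulnC leq_mul2l; apply/orP; right.
congr (_ ^+ _); apply: eq_bigr => i _.
by rewrite mulnC mulnBr [(m i * k)%N]mulnC.
Qed.

(** * Evaluation of the integral *)

Theorem theorem12 (p : nat) (pr : prime p) (p_odd : odd p) (R : realType)
    (K : fieldType) (v : K -> R) (iota : {rmorphism padicQ pr -> K})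
    (K_ext : padic_extension v iota)
    (s : nat) (s_gt0 : (0 < s)%N) (m n : 'I_s -> nat) (k : nat)
    (mn_gt : ((\sum_(i < s) m i) * k < \sum_(i < s) m i * n i)%N) :
  let M := (\sum_(i < s) m i * n i)%N in
  let T := (k * \sum_(i < s) m i)%N in
  has_fermionic_integral v
    (fun x : padicZ pr =>
       \prod_(i < s) (bernstein K k (n i)).[iota (padicZ_to_padicQ x)] ^+ m i)
    (iota (ratr
      (if k == 0%N then 2%:R + euler M
       else (\prod_(i < s) 'C(n i, k)%:R ^+ m i) *
            \sum_(0 <= j < T.+1) 'C(T, j)%:R * (-1) ^+ (T - j) * euler (M - j)))).
Proof.
move=> M T; have TM : (T < M)%N by rewrite /T mulnC.
set C : rat := \prod_(i < s) _.
set l : rat := if _ then _ else _.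
(* Both cases are the value at 0 of one polynomial: for k = 0 only j = 0 remains and C = 1; for k >
   0 the constants 2 cancel because T > 0. *)
have -> : l = (C *: mirror_euler_poly T M).[0].
  rewrite hornerZ horner0_mirror_euler_poly // /l; case: ifPn => [/eqP k0|k0].
    have C1 : C = 1 by apply: big1 => i _; rewrite k0 bin0 expr1n.
    by rewrite C1 /T k0 mul0n big_nat1 bin0 !subn0 expr0 !mul1r.
  congr (_ * _); under [RHS]eq_bigr => j _ do rewrite mulrDr.
  rewrite big_split /= -mulr_suml sum_signed_binomials ?mul0r ?add0r //.
  (* T > 0: if the [m i] summed to 0, all would vanish and [mn_gt] would read 0 < 0. *)
  rewrite muln_gt0 lt0n k0 lt0n; apply: contraTneq mn_gt => m0.
  rewrite -leqNgt m0 mul0n leqn0 sum_nat_eq0.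
  apply/forallP => i; apply/implyP => _; move/eqP: m0.
  by rewrite sum_nat_eq0 => /forallP/(_ i)/eqP->.
apply: (has_fermionic_integral_half_shift K_ext p_odd) => x.
have [phi phiE] := ratr_rmorphism (padicQ_natr_neq0 pr).
pose psi : {rmorphism rat -> K} := iota \o phi.
rewrite -phiE -[iota (phi _)]/(psi _) !hornerZ -mulrDr -natr1.
rewrite mirror_euler_poly_shift ?(ltnW TM) //.
(* The factor 2 of the shift equation cancels the division by 2. What remains is the Bernstein
   product over [rat], carried to [K] by [psi]. *)
rewrite [2%:R * _]mulrC mulrA mulfK // -prod_bernstein rmorph_prod.
apply: eq_bigr => i _; rewrite rmorphXn -horner_map; congr (_.[_] ^+ _).
  rewrite /bernstein map_polyZ /= !rmorph_nat rmorphM /= map_polyXn rmorphXn.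
  by rewrite rmorphB /= rmorph1 map_polyX.
by rewrite !rmorph_nat.
Qed.
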